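(* Let $n\in\mathbb{N}$, $r_1,\dots,r_n>0$, let $K$ be a singular, strictly concave and (strictly) monotone kernel function, and let $J$ be an upper semicontinuous $n$-field function. Then $M(S)=m(S)$ and there exists a unique equioscillation point $\mathbf{w}\in\overline{S}$, which, in fact, belongs to $Y\subseteq S$. This point $\mathbf{w}$ is the unique minimax point in $\overline{S}$, i.e. the unique point of $\overline{S}$ with $\overline{m}(\mathbf{w})=M(S)$, and it is the unique maximin point in $\overline{S}$, i.e. the unique point of $\overline{S}$ with $\underline{m}(\mathbf{w})=m(S)$. In particular, the so-called Sandwich Property holds: for any node system $\mathbf{x}\in S$ we have $\underline{m}(\mathbf{x})\le M(S)=m(S)\le\overline{m}(\mathbf{x})$.
   Context: A kernel function is a function $K:(-1,0)\cup(0,1)\to\mathbb{R}$ that is concave on $(-1,0)$ and concave on $(0,1)$ and satisfies $\lim_{t\downarrow0}K(t)=\lim_{t\uparrow0}K(t)$. It is extended to $[-1,1]$, with values in $\mathbb{R}\cup\{-\infty\}$, by $K(0):=\lim_{t\to0}K(t)$, $K(-1):=\lim_{t\downarrow-1}K(t)$, $K(1):=\lim_{t\uparrow1}K(t)$. $K$ is singular if $K(0)=-\infty$; strictly concave if it is strictly concave on each of $(-1,0)$ and $(0,1)$; monotone if it is monotone decreasing on $(-1,0)$ and monotone increasing on $(0,1)$; strictly monotone if it is strictly decreasing on $[-1,0)$ and strictly increasing on $(0,1]$ (a strictly concave monotone kernel is strictly monotone). An $n$-field function is a function $J:[0,1]\to\mathbb{R}\cup\{-\infty\}$ that is bounded above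 and takes finite values at more than $n$ different points, where the points $0$ and $1$ are counted with weight $1/2$ and points of $(0,1)$ with weight $1$. Let $S:=\{\mathbf{y}=(y_1,\dots,y_n)\in(0,1)^n: 0<y_1<\cdots<y_n<1\}$ and $\overline{S}:=\{\mathbf{y}\in[0,1]^n:0\le y_1\le\cdots\le y_n\le1\}$. For $\mathbf{y}\in\overline{S}$, $t\in[0,1]$ put $F(\mathbf{y},t):=J(t)+\sum_{j=1}^n r_jK(t-y_j)$. With $y_0:=0$, $y_{n+1}:=1$ put $I_j(\mathbf{y}):=[y_j,y_{j+1}]$ and $m_j(\mathbf{y}):=\sup_{t\in I_j(\mathbf{y})}F(\mathbf{y},t)$ for $j=0,1,\dots,n$; $\overline{m}(\mathbf{y}):=\max_{j}m_j(\mathbf{y})$, $\underline{m}(\mathbf{y}):=\min_{j}m_j(\mathbf{y})$; $M(S):=\inf_{\mathbf{x}\in S}\overline{m}(\mathbf{x})$, $m(S):=\sup_{\mathbf{x}\in S}\underline{m}(\mathbf{x})$. The regularity set is $Y:=\{\mathbf{y}\in S: m_j(\mathbf{y})\ne-\infty\text{ for }j=0,1,\dots,n\}$. A point $\mathbf{y}\in\overline{S}$ is an equioscillation point if $m_0(\mathbf{y})=m_1(\mathbf{y})=\cdots=m_n(\mathbf{y})$. *)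

(* Defs.v *)
From HB Require Import structures.
From mathcomp Require Import all_boot all_order all_algebra.
From mathcomp Require Import all_classical all_reals all_analysis.

Set Implicit Arguments.
Unset Strict Implicit.
Unset Printing Implicit Defensive.

Import Order.TTheory GRing.Theory Num.Theory.
Import numFieldNormedType.Exports.

Local Open Scope classical_set_scope.
Local Open Scope ring_scope.

Definition concave_on (R : realType) (D : set R) (f : R -> R) :=
  forall x y t, D x -> D y -> 0 <= t <= 1 ->
    t * f x + (1 - t) * f y <= f (t * x + (1 - t) * y).

Definition strictly_concave_on (R : realType) (D : set R) (f : R -> R) :=
  forall x y t, D x -> D y -> x != y -> 0 < t < 1 ->
    t * f x + (1 - t) * f y < f (t * x + (1 - t) * y).

(* A kernel is given by a total function K : R -> R, of which only the values
   on (-1, 0) and (0, 1) are ever used. The limits are taken in \bar R. *)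
Definition kernel_function (R : realType) (K : R -> R) :=
  [/\ concave_on `]-1, 0[ K,
      concave_on `]0, 1[ K &
      exists l : \bar R,
        (K t)%:E @[t --> 0^'+] --> l /\ (K t)%:E @[t --> 0^'-] --> l].

(* The extension of a kernel to [-1, 1]; its values outside [-1, 1] are
   irrelevant. The limits at -1 and 1 exist by concavity. *)
Definition kernel_ext (R : realType) (K : R -> R) (t : R) : \bar R :=
  if t == 0 then lim ((K s)%:E @[s --> 0^'])
  else if t == -1 then lim ((K s)%:E @[s --> (-1)^'+])
  else if t == 1 then lim ((K s)%:E @[s --> 1^'-])
  else (K t)%:E.

Definition singular_kernel (R : realType) (K : R -> R) :=
  kernel_ext K 0 = -oo%E.

Definition strictly_concave_kernel (R : realType) (K : R -> R) :=
  strictly_concave_on `]-1, 0[ K /\ strictly_concave_on `]0, 1[ K.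

Definition monotone_kernel (R : realType) (K : R -> R) :=
  {in `]-1, 0[ &, {homo K : s t / s <= t >-> t <= s}} /\
  {in `]0, 1[ &, {homo K : s t / s <= t}}.

Definition point_weight (R : realType) (t : R) : R :=
  if (t == 0) || (t == 1) then 1 / 2 else 1.

(* Only the values of J on [0, 1] matter. The last conjunct says that the
   weighted number of finiteness points of J, which may be infinite, exceeds n:
   some finite set of such points already has weight greater than n. *)
Definition field_function (R : realType) (n : nat) (J : R -> \bar R) :=
  (exists B : R, forall t, t \in `[0, 1] -> (J t <= B%:E)%E) /\
  (exists s : seq R,
     [/\ uniq s,
         {in s, forall t, t \in `[0, 1] /\ J t \is a fin_num} &
         n%:R < \sum_(t <- s) point_weight t]).

Definition upper_semicontinuous_on (R : realType) (D : set R)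
    (f : R -> \bar R) :=
  forall x (a : R), D x -> (f x < a%:E)%E ->
    \forall y \near within D (nbhs x), (f y < a%:E)%E.

(* The nodes y_0 = 0, y_1, ..., y_n, y_(n+1) = 1. The components of the row
   vector y are numbered from 0, so that y_(k+1) is y 0 k for k < n. *)
Definition node (R : realType) (n : nat) (y : 'rV[R]_n) (j : nat) : R :=
  if j is k.+1 then (if insub k is Some i then y 0 i else 1) else 0.

Definition open_simplex (R : realType) (n : nat) : set 'rV[R]_n :=
  [set y | forall j : 'I_n.+1, node y j < node y j.+1].

Definition closed_simplex (R : realType) (n : nat) : set 'rV[R]_n :=
  [set y | forall j : 'I_n.+1, node y j <= node y j.+1].

Arguments open_simplex R n : clear implicits.
Arguments closed_simplex R n : clear implicits.

Section translates.
Context {R : realType} {n : nat}.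
Variables (r : 'I_n -> R) (K : R -> R) (J : R -> \bar R).
Local Open Scope ereal_scope.

Definition sum_translates (y : 'rV[R]_n) (t : R) : \bar R :=
  J t + \sum_(j < n) (r j)%:E * kernel_ext K (t - y 0%R j)%R.

Definition interval_max (y : 'rV[R]_n) (j : 'I_n.+1) : \bar R :=
  ereal_sup [set sum_translates y t | t in `[node y j, node y j.+1]].

Definition max_interval_max (y : 'rV[R]_n) : \bar R :=
  \big[maxe/-oo]_(j < n.+1) interval_max y j.

Definition min_interval_max (y : 'rV[R]_n) : \bar R :=
  \big[mine/+oo]_(j < n.+1) interval_max y j.

Definition minimax : \bar R :=
  ereal_inf [set max_interval_max x | x in open_simplex R n].

Definition maximin : \bar R :=
  ereal_sup [set min_interval_max x | x in open_simplex R n].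

Definition regularity_set : set 'rV[R]_n :=
  [set y | open_simplex R n y /\ forall j, interval_max y j != -oo].

Definition equioscillation_point (y : 'rV[R]_n) :=
  closed_simplex R n y /\ forall j k, interval_max y j = interval_max y k.

Definition minimax_point (y : 'rV[R]_n) :=
  closed_simplex R n y /\ max_interval_max y = minimax.

Definition maximin_point (y : 'rV[R]_n) :=
  closed_simplex R n y /\ min_interval_max y = maximin.

End translates.

(* Main.v *)
Require Import Defs.
From HB Require Import structures.
From mathcomp Require Import all_boot all_order all_algebra.
From mathcomp Require Import all_classical all_reals all_analysis.
From mathcomp Require Import ring lra zify.

Set Implicit Arguments.
Unset Strict Implicit.
Unset Printing Implicit Defensive.

Import Order.TTheory GRing.Theory Num.Theory.
Import numFieldNormedType.Exports.

Local Open Scope classical_set_scope.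
Local Open Scope ring_scope.

(** The theorem rests on a comparison of two node systems. Given [y] in the
open simplex and another [x] in the closed simplex, consider the partial sums
C_i = sum_(k < i) r_k (x_k - y_k), for i = 0, ..., n, and let i minimise C.
Minimality of C_i against its neighbours says that the i-th interval of [x]
contains that of [y]. Minimality against all the others says that, seen from
a point t of that interval, the nodes on either side move away from t on
r-weighted average, with the nearest ones leading. As K grows with the distance
to 0 and is concave there, so that the nearest nodes weigh most, this forces
the sum of translates to be strictly larger at t for [x] than for [y]; formally
it is a summation by parts against supergradients of K
([sum_kernel_lt], [interval_max_lt]). Hence m_i(x) > m_i(y) for every such i.

Let w be a regular equioscillation point with common value mu. Comparing any
other x with w gives an index where m_i(x) > mu, and comparing w with x (when
all m_j(x) are finite) gives one where m_i(x) < mu. So every x other than w has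
its smallest interval maximum below mu and its largest one above mu
([equioscillation_strict]), which contains all the uniqueness and minimax
claims at once.

To find w, maximise the smallest interval maximum over the closed simplex. This
is possible because F is jointly upper semicontinuous and the simplex is
compact; the maximiser is an interior point because a singular kernel makes m_j
equal to -oo on a degenerate interval. If some m_j exceeded the minimum there,
shrink the j-th interval by moving its end nodes towards each other by amounts
inversely proportional to their weights. Then C is constant except at j, where
it is larger, so every i other than j minimises C and every other m_i increases,
while m_j stays above the old minimum if the move is small: the minimum would
have increased ([exists_equioscillation]). *)

(** * Kernels and their supergradients *)

(** The slope is the infimum of the slopes of the chords ending at [s]. It is
nonnegative by monotonicity, and concavity makes it work on both sides. *)
Lemma interior_supergradient (R : realType) (f : R -> R) (s : R) :
  strictly_concave_on `]0, 1[ f -> {in `]0, 1[ &, {homo f : a b / a <= b}} ->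
  0 < s < 1 ->
  exists2 p : R, 0 <= p &
    forall a : R, 0 < a < 1 -> a != s -> f a < f s + p * (a - s).
Proof.
move=> fconc fmon s01; case/andP: (s01) => s0 s1.
pose slope a := (f s - f a) / (s - a).
pose E := [set slope a | a in `]0, s[].
have slope_ge0 (a : R) : 0 < a < s -> 0 <= slope a.
  move=> /andP[a0 as_]; apply: divr_ge0; last by rewrite subr_ge0 ltW.
  by rewrite subr_ge0; apply: fmon; rewrite ?in_itv/= ?ltW //; lra.
have lbE : lbound E 0.
  by move=> _ /= [a + <-]; rewrite /= in_itv/= => /slope_ge0.
have hs : s / 2 \in `]0, s[ by rewrite in_itv/=; lra.
have E0 : E !=set0 by exists (slope (s / 2)); exists (s / 2).
have p_ge0 : 0 <= inf E by exact: lb_le_inf.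
have wconc (x y t : R) : 0 < x < 1 -> 0 < y < 1 -> 0 < t < 1 -> x != y ->
    t * f x + (1 - t) * f y < f (t * x + (1 - t) * y).
  by move=> x01 y01 t01 xy; apply: fconc => //; rewrite /= in_itv.
have super (a : R) : 0 < a < 1 -> f a <= f s + inf E * (a - s).
  move=> a01; have [as_|sa|->] := ltgtP a s; last by rewrite subrr mulr0 addr0.
    have : inf E <= slope a.
      by apply: ge_inf; [exists 0|exists a => //; rewrite /= in_itv/=; lra].
    by rewrite ler_pdivlMr; lra.
  have : (f a - f s) / (a - s) <= inf E.
    apply: lb_le_inf => // _ /= [b + <-]; rewrite /= in_itv/= => b0s.
    (* here b < s < a, and s is a convex combination of b and a *)
    have := @wconc b a ((a - s) / (a - b)).
    have -> : (a - s) / (a - b) * b + (1 - (a - s) / (a - b)) * a = s.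
      by field; apply/eqP; lra.
    move=> H; have {}H : (a - s) / (a - b) * f b
        + (1 - (a - s) / (a - b)) * f a < f s.
      apply: H; [by lra|by lra| |by apply/eqP; lra].
      by rewrite divr_gt0 ?ltr_pdivrMr; lra.
    have ab0 : 0 < a - b by lra.
    have e : (a - s) / (a - b) * f b + (1 - (a - s) / (a - b)) * f a =
      ((a - s) * f b + (s - b) * f a) / (a - b) by field; apply/eqP; lra.
    move: H; rewrite e ltr_pdivrMr// => H.
    rewrite ler_pdivlMr; [|by lra].
    rewrite mulrAC ler_pdivrMr; [|by lra].
    by lra.
  by rewrite ler_pdivrMr; lra.
exists (inf E) => // a a01 as_.
(* strictness comes from the weak inequality at the midpoint of a and s *)
have := @wconc a s 2^-1 a01 s01 ltac:(lra) as_.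
have := @super (2^-1 * a + (1 - 2^-1) * s) ltac:(lra).
lra.
Qed.

(** At the end point 1, where the value is the supremum, the slope 0 is a
supergradient. At interior points the inequality extends to 1 by taking
suprema. *)
Lemma closed_supergradient (R : realType) (f : R -> R) (g : R -> \bar R) :
  strictly_concave_on `]0, 1[ f -> {in `]0, 1[ &, {homo f : a b / a <= b}} ->
  (forall t : R, 0 < t < 1 -> g t = (f t)%:E) ->
  g 1 = ereal_sup [set (f t)%:E | t in `]0, 1[] ->
  (forall t : R, 0 < t <= 1 -> g t \is a fin_num) /\
  forall s : R, 0 < s <= 1 -> exists p : R, [/\ 0 <= p,
    forall a : R, 0 < a <= 1 -> fine (g a) <= fine (g s) + p * (a - s) &
    forall a : R, 0 < a < 1 -> a != s -> fine (g a) < fine (g s) + p * (a - s)].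
Proof.
move=> fconc fmon gf g1.
have super := interior_supergradient fconc fmon.
have fg1 (t : R) : 0 < t < 1 -> ((f t)%:E <= g 1%R)%E.
  move=> t01; rewrite g1; apply: ereal_sup_ubound.
  by exists t; rewrite //= in_itv.
have g1_le (b : R) : (forall t : R, 0 < t < 1 -> f t <= b) -> (g 1%R <= b%:E)%E.
  move=> fb; rewrite g1; apply: ge_ereal_sup => _ /= [t + <-].
  by rewrite /= in_itv/= lee_fin; exact: fb.
have super_le (s : R) : 0 < s < 1 -> exists2 p : R, 0 <= p &
    forall a : R, 0 < a < 1 -> f a <= f s + p * (a - s).
  move=> /super[p p0 ps]; exists p => // a a01.
  have [->|as_] := eqVneq a s; first by rewrite subrr mulr0 addr0.
  exact/ltW/ps.
have g1fin : g 1 \is a fin_num.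
  have [p p0 ps] := super_le 2^-1 ltac:(lra).
  rewrite fin_real//; apply/andP; split.
    by apply: lt_le_trans (fg1 2^-1 ltac:(lra)); rewrite ltNyr.
  apply: (@le_lt_trans _ _ (f 2^-1 + p)%:E); last by rewrite ltry.
  apply: g1_le => t t01; apply: (le_trans (ps _ t01)); rewrite lerD2l.
  by apply: ler_piMr => //; lra.
have gfin (t : R) : 0 < t <= 1 -> g t \is a fin_num.
  move=> t01; have [->//|t1] := eqVneq t 1.
  by rewrite gf// (lt_neqAle t) t1.
split=> // s s01.
have fine_lt (a : R) : 0 < a < 1 -> fine (g a) = f a by move=> /gf ->.
have f_le1 (a : R) : 0 < a < 1 -> f a <= fine (g 1).
  by move=> a01; rewrite -lee_fin fineK//; exact: fg1.
have [->|s1] := eqVneq s 1.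
  have flt (a : R) : 0 < a < 1 -> f a < fine (g 1).
    move=> a01; pose b := (a + 1) / 2.
    have [p p0 ps] := super b ltac:(rewrite /b; lra).
    have := ps a a01 ltac:(apply/eqP; rewrite /b; lra).
    have := f_le1 b ltac:(rewrite /b; lra).
    have : p * (a - b) <= 0 by apply: mulr_ge0_le0; rewrite /b//; lra.
    lra.
  exists 0; split => // a a01; rewrite mul0r addr0.
    have [->//|a1] := eqVneq a 1.
    have a01' : 0 < a < 1 by rewrite (lt_neqAle a) a1.
    by rewrite fine_lt// f_le1.
  by move=> _; rewrite fine_lt// flt.
have {}s01 : 0 < s < 1 by rewrite (lt_neqAle s) s1.
have [p p0 ps] := super s s01.
exists p; split => // a a01; rewrite (fine_lt s)//; last first.
  by move=> as_; rewrite fine_lt// ps.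
have ps_le (b : R) : 0 < b < 1 -> f b <= f s + p * (b - s).
  move=> b01; have [->|as_] := eqVneq b s; first by rewrite subrr mulr0 addr0.
  exact/ltW/ps.
have [->|a1] := eqVneq a 1; last first.
  have a01' : 0 < a < 1 by rewrite (lt_neqAle a) a1.
    by rewrite fine_lt// ps_le.
rewrite -lee_fin fineK//; apply: g1_le => t t01.
by apply: le_trans (ps_le _ t01) _; rewrite lerD2l ler_wpM2l//; lra.
Qed.

Lemma kernel_extE (R : realType) (K : R -> R) t :
  t != 0 -> -1 < t < 1 -> kernel_ext K t = (K t)%:E.
Proof.
move=> t0 /andP[tN1 t1]; rewrite /kernel_ext (negPf t0).
by rewrite (gt_eqF tN1) (lt_eqF t1).
Qed.

Lemma kernel_extN1 (R : realType) (K : R -> R) : monotone_kernel K ->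
  kernel_ext K (-1) = ereal_sup [set (K t)%:E | t in `]-1, 0[].
Proof.
move=> [Kdecr _]; rewrite /kernel_ext oppr_eq0 oner_eq0 eqxx.
apply: cvg_lim => //.
apply: (@nonincreasing_at_right_cvge _ (EFin \o K) (-1) (BLeft 0)).
  by rewrite ltBSide/= ltrN10.
by move=> a b aI bI ab; rewrite /= lee_fin Kdecr.
Qed.

Lemma kernel_ext1 (R : realType) (K : R -> R) : monotone_kernel K ->
  kernel_ext K 1 = ereal_sup [set (K t)%:E | t in `]0, 1[].
Proof.
move=> [_ Kincr]; rewrite /kernel_ext oner_eq0 eqxx.
rewrite gt_eqF ?(lt_trans ltrN10)//.
apply: cvg_lim => //; apply/cvg_at_leftNP.
have -> : [set (K t)%:E | t in `]0, 1[] =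
    ((EFin \o K) \o -%R) @` [set` `]-1, 0[].
  apply/seteqP; split => _ /= [t + <-]; rewrite /= !in_itv/= => t01.
    by exists (- t); rewrite /= ?opprK// in_itv/=; lra.
  by exists (- t) => //; rewrite /= in_itv/=; lra.
apply: (@nonincreasing_at_right_cvge _ ((EFin \o K) \o -%R) (-1) (BLeft 0)).
  by rewrite ltBSide/= ltrN10.
move=> a b; rewrite /= !in_itv/= => aI bI ab; rewrite /= lee_fin.
by apply: Kincr; rewrite ?in_itv/=; lra.
Qed.

(** Both sides of 0 at once: [0 < a * s] says that [a] and [s] lie on the same
side, and [0 <= p * s] that the kernel grows with the distance to 0. The
strict inequality is claimed only away from the end points 1 and -1, which
suffices for differences between a point of [0, 1] and a node of the open
simplex. *)
Lemma kernel_supergradient (R : realType) (K : R -> R) :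
  strictly_concave_kernel K -> monotone_kernel K ->
  (forall t : R, -1 <= t <= 1 -> t != 0 -> kernel_ext K t \is a fin_num) /\
  forall s : R, -1 <= s <= 1 -> s != 0 -> exists p : R, [/\ 0 <= p * s,
    forall a : R, -1 <= a <= 1 -> 0 < a * s ->
      fine (kernel_ext K a) <= fine (kernel_ext K s) + p * (a - s) &
    forall a : R, -1 < a < 1 -> 0 < a * s -> a != s ->
      fine (kernel_ext K a) < fine (kernel_ext K s) + p * (a - s)].
Proof.
move=> [concN concP] mon; case: (mon) => decN incP.
have [finP supP] := @closed_supergradient _ K (kernel_ext K) concP incP
  ltac:(by move=> t t01; apply: kernel_extE; [apply/eqP|]; lra)
  (kernel_ext1 mon).
have [||||finN supN] :=
  @closed_supergradient _ (K \o -%R) (kernel_ext K \o -%R).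
- move=> x y t; rewrite /= !in_itv/= => x01 y01 xy t01.
  have -> : - (t * x + (1 - t) * y) = t * (- x) + (1 - t) * (- y) by ring.
  by apply: concN; rewrite //= ?in_itv/= ?eqr_opp//; lra.
- move=> a b; rewrite /= !in_itv/= => a01 b01 ab.
  by apply: decN; rewrite ?in_itv/=; lra.
- by move=> t t01 /=; apply: kernel_extE; [apply/eqP|]; lra.
- rewrite /= kernel_extN1//; congr ereal_sup.
  apply/seteqP; split => _ /= [t + <-]; rewrite /= !in_itv/= => t01.
    by exists (- t); rewrite ?opprK// in_itv/=; lra.
  by exists (- t) => //; rewrite /= in_itv/=; lra.
split=> [t t11 t0|s s11 s0].
  have [t_lt0|t_gt0|/eqP] := ltgtP t 0; last by rewrite (negPf t0).
    by rewrite -(opprK t); apply: finN; lra.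
  by apply: finP; lra.
have [s_lt0|s_gt0|/eqP] := ltgtP s 0; last by rewrite (negPf s0).
  have [p [p0 ps pS]] := supN (- s) ltac:(lra).
  exists (- p); split.
  - by rewrite mulNr -mulrN mulr_ge0//; lra.
  - move=> a a11; rewrite nmulr_lgt0// => a0.
    by have := ps (- a) ltac:(lra); rewrite /= !opprK; lra.
  - move=> a a11; rewrite nmulr_lgt0// => a0 as_.
    have := pS (- a) ltac:(lra); rewrite eqr_opp => /(_ as_).
    by rewrite /= !opprK; lra.
have [p [p0 ps pS]] := supP s ltac:(lra).
exists p; split.
- by rewrite mulr_ge0//; lra.
- by move=> a a11; rewrite pmulr_lgt0// => a0; apply: ps; lra.
- by move=> a a11; rewrite pmulr_lgt0// => a0 as_; apply: pS => //; lra.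
Qed.

Lemma kernel_ext0_near (R : realType) (K : R -> R) (a : R) :
  kernel_function K -> singular_kernel K ->
  \forall t \near (0 : R), -1 <= t <= 1 -> (kernel_ext K t < a%:E)%E.
Proof.
move=> [_ _ [l [Kr Kl]]] sing.
have Kl0 : (K s)%:E @[s --> 0^'] --> l.
  move=> /= U lU; have := Kr U lU; have := Kl U lU.
  rewrite !nbhs_simpl/= => -[e1 /= e1_gt0 H1] [e2 /= e2_gt0 H2].
  exists (Num.min e1 e2); first by rewrite /= lt_min e1_gt0.
  move=> t /=; rewrite lt_min => /andP[t1 t2] t0.
  by have [tn|tp|/eqP] := ltgtP t 0; [exact: H1|exact: H2|rewrite (negPf t0)].
have lE : l = -oo%E.
  by rewrite -sing /kernel_ext eqxx; apply/esym/cvg_lim.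
have : \forall s \near 0^', ((K s)%:E < a%:E)%E.
  by rewrite lE in Kl0; exact: cvgeNy_lt.
rewrite near_withinE; apply: filterS2 (nbhs0_lt ltr01) => t t_lt1 Kt t11.
have [t0|t0] := eqVneq t 0; first by rewrite t0 [kernel_ext _ _]sing ltNyr.
rewrite kernel_extE//; first exact: Kt.
by move: t_lt1; rewrite ltr_norml.
Qed.

(** Upper semicontinuity of the extended kernel on [-1, 1]. Away from 0 it
follows from the affine upper bound given by a supergradient. *)
Lemma kernel_ext_lt (R : realType) (K : R -> R) (s a : R) :
  kernel_function K -> singular_kernel K -> strictly_concave_kernel K ->
  monotone_kernel K -> -1 <= s <= 1 -> (kernel_ext K s < a%:E)%E ->
  \forall t \near s, -1 <= t <= 1 -> (kernel_ext K t < a%:E)%E.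
Proof.
move=> kK sK cK mK s11; have [finK supK] := kernel_supergradient cK mK.
have [->|s0] := eqVneq s 0; first by move=> _; exact: kernel_ext0_near.
have [p [_ ps _]] := supK s s11 s0.
rewrite -{1}(fineK (finK s s11 s0)) lte_fin => sa.
have c1 : fine (kernel_ext K s) + p * (t - s) @[t --> s]
    --> fine (kernel_ext K s) + p * (s - s).
  by apply: cvgD; [exact: cvg_cst|apply: cvgM; [exact: cvg_cst|]];
    apply: cvgB; [exact: cvg_id|exact: cvg_cst].
have c2 : t * s @[t --> s] --> s * s.
  by apply: cvgM; [exact: cvg_id|exact: cvg_cst].
rewrite subrr mulr0 addr0 in c1.
have ss : 0 < s * s by rewrite -expr2 exprn_even_gt0.
near=> t => t11.
have ts : 0 < t * s by near: t; exact: (cvgr_gt _ c2).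
have t0 : t != 0 by apply: contraTneq ts => ->; rewrite mul0r ltxx.
rewrite -(fineK (finK t t11 t0)) lte_fin.
apply: le_lt_trans (ps t t11 ts) _.
by near: t; exact: (cvgr_lt _ c1).
Unshelve. all: by end_near. Qed.

(** * Upper semicontinuous functions *)

Section semicontinuity.
Context {R : realType}.
Implicit Types T U : topologicalType.

Definition usc_on T (A : set T) (f : T -> \bar R) :=
  forall x (a : R), A x -> (f x < a%:E)%E ->
    \forall y \near x, A y -> (f y < a%:E)%E.

Lemma usc_on_subset T (A B : set T) (f : T -> \bar R) :
  A `<=` B -> usc_on B f -> usc_on A f.
Proof.
move=> AB uf x a Ax fx; apply: filterS (uf x a (AB _ Ax) fx) => y fy Ay.
exact/fy/AB.
Qed.

Lemma adde_lt_split (u v : \bar R) (a : R) :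
  (u < +oo)%E -> (v < +oo)%E -> (u + v < a%:E)%E ->
  exists b c : R, [/\ (u < b%:E)%E, (v < c%:E)%E & b + c = a].
Proof.
case: u => [u| |]//; case: v => [v| |]// _ _.
- rewrite -EFinD lte_fin => uva.
  by exists ((a + u - v) / 2), ((a - u + v) / 2); rewrite !lte_fin; split; lra.
- move=> _; exists (u + 1), (a - (u + 1)).
  by rewrite lte_fin ltNyr; split=> //; lra.
- move=> _; exists (a - (v + 1)), (v + 1).
  by rewrite lte_fin ltNyr; split=> //; lra.
- by move=> _; exists 0, a; rewrite !ltNyr add0r.
Qed.

Lemma usc_onD T (A : set T) (f g : T -> \bar R) :
  (forall x, A x -> (f x < +oo)%E) -> (forall x, A x -> (g x < +oo)%E) ->
  usc_on A f -> usc_on A g -> usc_on A (fun x => f x + g x)%E.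
Proof.
move=> fy gy uf ug x a Ax.
move=> /(adde_lt_split (fy x Ax) (gy x Ax))[b [c [fb gc <-]]].
apply: filterS2 (uf x b Ax fb) (ug x c Ax gc) => y fyb gyc Ay.
by rewrite EFinD lteD// ?fyb ?gyc.
Qed.

Lemma usc_onZ T (A : set T) (r : R) (f : T -> \bar R) :
  0 < r -> usc_on A f -> usc_on A (fun x => r%:E * f x)%E.
Proof.
move=> r0 uf x a Ax; rewrite -lte_pdivlMl// -EFinM => /(uf _ _ Ax).
by apply: filterS => y fy Ay; rewrite -lte_pdivlMl// -EFinM fy.
Qed.

Lemma usc_on_sum T (A : set T) (I : Type) (s : seq I) (f : I -> T -> \bar R) :
  (forall i x, A x -> (f i x < +oo)%E) -> (forall i, usc_on A (f i)) ->
  usc_on A (fun x => \sum_(i <- s) f i x)%E.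
Proof.
move=> fy uf; elim: s => [|i s IH] x a Ax.
  by rewrite big_nil => a0; apply: filterE => y _; rewrite big_nil.
have sy y : A y -> (\sum_(k <- s) f k y < +oo)%E.
  by move=> Ay; apply: lte_sum_pinfty => k _; exact: fy.
rewrite big_cons => /(usc_onD (fy i) sy (uf i) IH Ax).
by apply: filterS => y + Ay; rewrite big_cons; exact.
Qed.

Lemma usc_on_comp T U (A : set T) (B : set U) (h : T -> U) (f : U -> \bar R) :
  continuous h -> (forall x, A x -> B (h x)) -> usc_on B f -> usc_on A (f \o h).
Proof.
move=> ch AB uf x a Ax fa.
have : nbhs x (h @^-1` [set y | B y -> (f y < a%:E)%E]).
  exact/ch/(uf _ _ (AB _ Ax) fa).
by apply: filterS => y /= fy Ay; exact/fy/AB.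
Qed.

(** Without a maximum, the strict sublevel sets of [f] below its own values
would cover [A], directed by the order of those values, and compactness would
yield a value above all the others, itself included. *)
Lemma usc_on_max T (A : set T) (f : T -> \bar R) :
  compact A -> A !=set0 -> usc_on A f ->
  exists2 z, A z & forall t, A t -> (f t <= f z)%E.
Proof.
move=> /compact_near_coveringP cA [x0 Ax0] uf; apply: contrapT => nomax.
have {}nomax z : A z -> exists2 t, A t & (f z < f t)%E.
  move=> Az; apply: contrapT => h; apply: nomax; exists z => // t At.
  by rewrite leNgt; apply/negP => ft; apply: h; exists t.
(* the filter of the points of A where f is large *)
pose F := filter_from A (fun s => [set t | A t /\ (f s <= f t)%E]).
have FF : Filter F.
  apply: filter_from_filter; first by exists x0.
  move=> s t As At; have [st|/ltW ts] := leP (f s) (f t).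
    exists t => // u [Au tu]; split; split => //; exact: le_trans st tu.
  by exists s => // u [Au su]; split; split => //; exact: le_trans ts su.
have : \near F, A `<=` [set x | A x -> (f x < f F)%E]; last first.
  by case=> s As sP; have := sP s (conj As (lexx _)) s As As; rewrite ltxx.
apply: (cA _ F (fun t x => A x -> (f x < f t)%E)) => x Ax.
have [t At xt] := nomax x Ax.
have [b xb bt] : exists2 b : R, (f x < b%:E)%E & (b%:E <= f t)%E.
  move: xt; case: (f x) => [u| |]; case: (f t) => [v| |]//=.
  - by rewrite lte_fin => uv; exists v; rewrite ?lte_fin.
  - by move=> _; exists (u + 1); rewrite ?lte_fin ?ltrDl ?leey.
  - by move=> _; exists v; rewrite ?ltNyr.
  - by move=> _; exists 0; rewrite ?ltNyr ?leey.
exists ([set y | A y -> (f y < b%:E)%E], [set s | A s /\ (f t <= f s)%E]).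
  by split; [exact: uf|exists t].
move=> [y s] /= [fyb [As ts]] Ay.
exact: lt_le_trans (fyb Ay) (le_trans bt ts).
Qed.

(** A tube argument: off the closed set [E] there is nothing to check nearby,
and compactness of [B] makes the neighbourhoods of [x] uniform in the fibre
variable. *)
Lemma usc_on_sup_fiber T U (A : set T) (B : set U) (E : set (T * U))
    (f : T * U -> \bar R) :
  compact B -> closed E -> (forall p, E p -> B p.2) -> usc_on E f ->
  usc_on A (fun x => ereal_sup [set f (x, t) | t in [set t | E (x, t)]]).
Proof.
move=> /compact_near_coveringP cB cE EB uf x a _.
set M := ereal_sup _ => Ma.
have [b Mb ba] : exists2 b : R, (M < b%:E)%E & b < a.
  move: Ma; case: M => [u| |]//.
    by rewrite lte_fin => ua; exists ((u + a) / 2); rewrite ?lte_fin; lra.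
  by move=> _; exists (a - 1); rewrite ?ltNyr//; lra.
have : \forall y \near x, B `<=` [set t | E (y, t) -> (f (y, t) < b%:E)%E].
  apply: (cB _ (nbhs x) (fun y t => E (y, t) -> (f (y, t) < b%:E)%E)) => t Bt.
  have : \forall p \near (x, t), E p -> (f p < b%:E)%E.
    have [Ext|nExt] := pselect (E (x, t)).
      apply: uf => //; apply: le_lt_trans Mb; apply: ereal_sup_ubound.
      by exists t.
    have : nbhs (x, t) (~` E).
      by apply: open_nbhs_nbhs; split => //; exact: closed_openC.
    by apply: filterS => p nEp /nEp.
  case=> -[/= P Q] [xP tQ] PQ; exists (Q, P) => // -[t' y] /= [Qt' Py].
  exact: (PQ (y, t')).
apply: filterS => y Hy _.
apply: (@le_lt_trans _ _ b%:E); last by rewrite lte_fin.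
apply: ge_ereal_sup => _ /= [t Eyt <-]; apply/ltW/Hy => //.
exact: (EB _ Eyt).
Qed.

Lemma usc_on_bigmin T (A : set T) n (f : 'I_n -> T -> \bar R) :
  (forall i, usc_on A (f i)) ->
  usc_on A (fun x => \big[mine/+oo%E]_(i < n) f i x).
Proof.
move=> uf x a Ax /bigmin_ltP[|[i _ fia]]; first by rewrite ltNge leey.
apply: filterS (uf i x a Ax fia) => y fy Ay; apply/bigmin_ltP.
by right; exists i => //; exact: fy.
Qed.

Lemma closed_le_fun T (f g : T -> R) :
  continuous f -> continuous g -> closed [set x : T | f x <= g x].
Proof.
move=> cf cg.
rewrite (_ : mkset _ = (fun x : T => g x - f x) @^-1` [set u | 0 <= u]).
  apply: closed_comp; last exact: closed_ge.
  by move=> x _; apply: cvgB; [exact: cg|exact: cf].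
by apply/seteqP; split => x /=; rewrite subr_ge0.
Qed.

End semicontinuity.

(** * Node systems and the comparison of sums of kernels *)

Lemma sum_by_parts (R : comNzRingType) (D E : nat -> R) (n : nat) :
  \sum_(k < n) (D k.+1 - D k) * E k.+1 =
  \sum_(k < n.+1) D k * (E k - E k.+1) + D n * E n.+1 - D 0 * E 0.
Proof.
elim: n => [|n IH]; first by rewrite big_ord0 big_ord1; ring.
by rewrite big_ord_recr [in RHS]big_ord_recr /= IH; ring.
Qed.

Section simplex.
Context {R : realType} {n : nat}.
Implicit Types (x y : 'rV[R]_n) (k : 'I_n).

Lemma nodeS x k : node x k.+1 = x 0 k.
Proof. by rewrite /= valK. Qed.

Lemma node_last x : node x n.+1 = 1.
Proof. by rewrite /= insubN ?ltnn. Qed.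

Lemma sub_open_closed_simplex x : open_simplex R n x -> closed_simplex R n x.
Proof. by move=> xS j; apply: ltW. Qed.

Lemma node_le x (i k : nat) : closed_simplex R n x ->
  (i <= k <= n.+1)%N -> node x i <= node x k.
Proof.
move=> xS /andP[]; elim: k => [|k IH]; first by rewrite leqn0 => /eqP->.
rewrite leq_eqVlt => /predU1P[->//|ik] kn.
exact: le_trans (IH ik (ltnW kn)) (xS (Ordinal kn)).
Qed.

Lemma simplex_itv x k : closed_simplex R n x -> 0 <= x 0 k <= 1.
Proof.
move=> xS; have kn := ltn_ord k; rewrite -nodeS; apply/andP; split.
  by apply: (@node_le x 0); rewrite //= ltnS ltnW.
by rewrite -(node_last x); apply: node_le => //; lia.
Qed.

Lemma open_simplex_itv x k : open_simplex R n x -> 0 < x 0 k < 1.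
Proof.
move=> xS; have xS' := sub_open_closed_simplex xS.
have kn := ltn_ord k; rewrite -nodeS; apply/andP; split.
  apply: le_lt_trans (xS (widen_ord (leqnSn n) k)).
  by apply: (@node_le x 0) => //=; lia.
rewrite -(node_last x); apply: lt_le_trans (xS (lift ord0 k)) _.
by apply: node_le => //; rewrite /= /bump; lia.
Qed.

Lemma node_itv x (i : nat) : closed_simplex R n x -> (i <= n.+1)%N ->
  0 <= node x i <= 1.
Proof.
by move=> xS i_n; rewrite (@node_le x 0)//= -(node_last x) node_le// i_n leqnn.
Qed.

End simplex.

Section displacement.
Context {R : realType} {n : nat} (r : 'I_n -> R).
Hypothesis r_gt0 : forall j, 0 < r j.
Implicit Types (x y : 'rV[R]_n) (k : 'I_n).

Definition displacement x y (i : nat) : R :=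
  \sum_(k < n | (k < i)%N) r k * (x 0 k - y 0 k).

Lemma displacementS x y k :
  displacement x y k.+1 = displacement x y k + r k * (x 0 k - y 0 k).
Proof.
rewrite /displacement (bigD1 k)//= addrC; congr (_ + _).
by apply: eq_bigl => l; rewrite ltnS ltn_neqAle andbC.
Qed.

(** The displacement is smallest at [i]: the nodes on both sides of the [i]-th
interval of [y] recede from it, on [r]-weighted average, on their way to
[x]. *)
Definition balanced x y (i : nat) :=
  forall l, (l <= n)%N -> displacement x y i <= displacement x y l.

Lemma exists_balanced x y : exists i : 'I_n.+1, balanced x y i.
Proof.
have [i _ ile] := @arg_minP _ _ _ (@ord0 n) predT
  (fun i : 'I_n.+1 => displacement x y i) isT.
by exists i => l ln; exact: (ile (Ordinal (ln : l < n.+1)%N) isT).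
Qed.

Lemma balanced_left x y (i : nat) : (i <= n)%N -> balanced x y i ->
  node x i <= node y i.
Proof.
case: i => [//|i] i_n xy; have := xy i (ltnW i_n).
rewrite (nodeS x (Ordinal i_n)) (nodeS y (Ordinal i_n)).
by rewrite (displacementS _ _ (Ordinal i_n)) gerDl pmulr_rle0// subr_le0.
Qed.

Lemma balanced_right x y (i : nat) : (i <= n)%N -> balanced x y i ->
  node y i.+1 <= node x i.+1.
Proof.
rewrite leq_eqVlt => /predU1P[-> _|i_n xy]; first by rewrite !node_last.
have := xy _ i_n; rewrite (nodeS x (Ordinal i_n)) (nodeS y (Ordinal i_n)).
by rewrite (displacementS _ _ (Ordinal i_n)) lerDl pmulr_rge0// subr_ge0.
Qed.

Context (K : R -> R).
Hypothesis concaveK : strictly_concave_kernel K.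
Hypothesis monotoneK : monotone_kernel K.

(** With q_k a supergradient of the kernel at t - x_k, the right-hand side minus
the left-hand one is more than - sum_k r_k (x_k - y_k) q_k. Put D_l =
displacement l - displacement i, which is nonnegative. Summing by parts, this
is a combination of the D_l with coefficients q_l - q_(l-1), where q is extended
by 0 at both ends. Since q is nonnegative and nondecreasing to the left of [t],
nonpositive and nondecreasing to its right, those coefficients are nonnegative
except perhaps for l = i, where D vanishes. *)
Lemma sum_kernel_lt x y (i : nat) (t : R) :
  closed_simplex R n x -> x != y -> (i <= n)%N -> balanced x y i ->
  0 <= t <= 1 -> (forall k, 0 < y 0 k < 1) ->
  (forall k, (k < i)%N -> x 0 k < t /\ y 0 k < t) ->
  (forall k, (i <= k)%N -> t < x 0 k /\ t < y 0 k) ->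
  \sum_(k < n) r k * fine (kernel_ext K (t - y 0 k)) <
  \sum_(k < n) r k * fine (kernel_ext K (t - x 0 k)).
Proof.
move=> xS xy i_n bal t01 y01 left right.
set kap := fun s => fine (kernel_ext K s).
have [_ supK] := kernel_supergradient concaveK monotoneK.
have /choice[p pP] : forall s : R, exists p : R, -1 <= s <= 1 -> s != 0 ->
    [/\ 0 <= p * s,
      forall a : R, -1 <= a <= 1 -> 0 < a * s -> kap a <= kap s + p * (a - s) &
      forall a : R, -1 < a < 1 -> 0 < a * s -> a != s ->
        kap a < kap s + p * (a - s)].
  move=> s; have [s11|ns] := boolP (-1 <= s <= 1); last by exists 0.
  have [->|s0] := eqVneq s 0; first by exists 0 => _ /eqP.
  by have [q qP] := supK s s11 s0; exists q.
have x01 k := simplex_itv k xS.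
have d11 k : -1 <= t - x 0 k <= 1 by have := x01 k; lra.
have dn0 k : t - x 0 k != 0.
  rewrite subr_eq0; have [/left[xt _]|/right[tx _]] := ltnP k i.
    by rewrite gt_eqF.
  by rewrite lt_eqF.
have same k : 0 < (t - y 0 k) * (t - x 0 k).
  have [/left[xt yt]|/right[tx ty]] := ltnP k i.
    by rewrite mulr_gt0// subr_gt0.
  by rewrite nmulr_rgt0 subr_lt0.
pose q k := p (t - x 0 k).
have tangent_lt k : x 0 k != y 0 k ->
    kap (t - y 0 k) < kap (t - x 0 k) + q k * (x 0 k - y 0 k).
  move=> xyk; have [_ _ /(_ (t - y 0 k))] := pP _ (d11 k) (dn0 k).
  have -> : t - y 0 k - (t - x 0 k) = x 0 k - y 0 k by ring.
  apply=> //; first by have := y01 k; lra.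
  by apply: contra xyk => /eqP e; apply/eqP; lra.
have tangent_le k :
    kap (t - y 0 k) <= kap (t - x 0 k) + q k * (x 0 k - y 0 k).
  have [->|xyk] := eqVneq (x 0 k) (y 0 k); first by rewrite subrr mulr0 addr0.
  exact/ltW/tangent_lt.
have [k0 xyk0] : exists k, x 0 k != y 0 k.
  apply/existsP; apply: contraTT xy => /existsPn xy; apply/negPn/eqP/rowP => k.
  by apply/eqP/negPn; exact: xy.
apply: (@lt_le_trans _ _
    (\sum_(k < n) r k * (kap (t - x 0 k) + q k * (x 0 k - y 0 k)))).
  rewrite (bigD1 k0)//= [ltRHS](bigD1 k0)//= ltr_leD// ?ltr_pM2l ?tangent_lt//.
  by apply: ler_sum => k _; rewrite ler_pM2l ?tangent_le.
under eq_bigr do rewrite mulrDr.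
rewrite big_split/= gerDl.
(* E l.+1 is the supergradient at the node l; both ends are padded with 0 *)
pose E (l : nat) := if l is l'.+1 then oapp q 0 (insub l') else 0.
have ES k : E k.+1 = q k by rewrite /E valK.
pose D l := displacement x y l - displacement x y i.
have -> : \sum_(k < n) r k * (q k * (x 0 k - y 0 k)) =
    \sum_(k < n) (D k.+1 - D k) * E k.+1.
  by apply: eq_bigr => k _; rewrite ES /D displacementS; ring.
have EnS : E n.+1 = 0 by rewrite /E insubN ?ltnn.
have E0 : E 0%N = 0 by [].
clearbody E; rewrite sum_by_parts EnS E0 !mulr0 subr0 addr0.
have q_left k : (k < i)%N -> 0 <= q k.
  move=> /left[xt _]; have [+ _ _] := pP _ (d11 k) (dn0 k).
  by rewrite pmulr_lge0// subr_gt0.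
have q_right k : (i <= k)%N -> q k <= 0.
  move=> /right[tx _]; have [+ _ _] := pP _ (d11 k) (dn0 k).
  by rewrite nmulr_lge0// subr_lt0.
(* each of two points on one side lies under the tangent at the other *)
have q_mono (k l : 'I_n) : (k <= l)%N ->
    0 < (t - x 0 k) * (t - x 0 l) -> q k <= q l.
  move=> kl kl0; have : x 0 k <= x 0 l.
    by rewrite -!nodeS; apply: node_le => //; have := ltn_ord l; lia.
  rewrite le_eqVlt => /predU1P[e|xkl]; first by rewrite /q e.
  have [_ /(_ _ (d11 l)) pk _] := pP _ (d11 k) (dn0 k).
  have [_ /(_ _ (d11 k) kl0) pl _] := pP _ (d11 l) (dn0 l).
  have {pk} := pk; rewrite mulrC => /(_ kl0) pk.
  rewrite /q; have : 0 <= (p (t - x 0 l) - p (t - x 0 k)) * (x 0 l - x 0 k).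
    by lra.
  by rewrite pmulr_lge0 ?subr_gt0// subr_ge0.
apply: sumr_le0 => l _; have ln := ltn_ord l.
have D_ge0 : 0 <= D l by rewrite subr_ge0; exact: bal.
have [li|il|e] := ltngtP l i; last by rewrite /D e subrr mul0r.
  apply: mulr_ge0_le0 => //; rewrite subr_le0.
  have lt_n : (l < n)%N by exact: leq_trans i_n.
  rewrite (ES (Ordinal lt_n)).
  case: l li ln lt_n {D_ge0} => -[|l] //= _ li _ lt_n.
    by rewrite E0; exact: q_left.
  have lt_n' : (l < n)%N by exact: ltnW.
  rewrite (ES (Ordinal lt_n')); apply: q_mono => //=.
  have [//|a _] := left (Ordinal lt_n); have [|b _] := left (Ordinal lt_n').
    exact: ltnW.
  by rewrite mulr_gt0 ?subr_gt0.
apply: mulr_ge0_le0 => //; rewrite subr_le0.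
case: l il ln {D_ge0} => -[|l] //= lt_n1 il _.
have lt_n : (l < n)%N by [].
rewrite (ES (Ordinal lt_n)).
have [ln'|] := ltnP l.+1 n; last first.
  by move=> nl; rewrite (_ : l.+1 = n) ?EnS ?q_right//; lia.
rewrite (ES (Ordinal ln')); apply: q_mono => //=.
have [//|a _] := right (Ordinal lt_n); have [|b _] := right (Ordinal ln').
  exact: ltnW.
by rewrite nmulr_rgt0 ?subr_lt0.
Qed.

End displacement.

(** * Interval maxima of sums of translates *)

Section sum_of_translates.
Context {R : realType} {n : nat} (r : 'I_n -> R) (K : R -> R) (J : R -> \bar R).
Hypothesis r_gt0 : forall j, 0 < r j.
Hypothesis kernelK : kernel_function K.
Hypothesis singularK : singular_kernel K.
Hypothesis concaveK : strictly_concave_kernel K.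
Hypothesis monotoneK : monotone_kernel K.
Hypothesis fieldJ : field_function n J.
Hypothesis uscJ : upper_semicontinuous_on `[0, 1] J.
Implicit Types (x y : 'rV[R]_n) (k : 'I_n) (j : 'I_n.+1).

Local Notation F := (sum_translates r K J).
Local Notation m := (interval_max r K J).

Lemma kernel_ext_fin_num (s : R) : -1 <= s <= 1 -> s != 0 ->
  kernel_ext K s \is a fin_num.
Proof. by have [+ _] := kernel_supergradient concaveK monotoneK; exact. Qed.

Lemma kernel_ext_lty (s : R) : -1 <= s <= 1 -> (kernel_ext K s < +oo)%E.
Proof.
move=> s11; have [->|s0] := eqVneq s 0.
  by rewrite [X in (X < _)%E]singularK.
by rewrite ltey_eq kernel_ext_fin_num.
Qed.

Lemma field_lty (t : R) : 0 <= t <= 1 -> (J t < +oo)%E.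
Proof.
case: fieldJ => -[B JB] _ t01.
by apply: le_lt_trans (JB t _) (ltry _); rewrite in_itv.
Qed.

Lemma subr_node_itv x k (t : R) : closed_simplex R n x -> 0 <= t <= 1 ->
  -1 <= t - x 0 k <= 1.
Proof. by move=> /(simplex_itv k); lra. Qed.

Lemma translate_lty x k (t : R) : closed_simplex R n x -> 0 <= t <= 1 ->
  ((r k)%:E * kernel_ext K (t - x 0 k)%R < +oo)%E.
Proof.
move=> xS t01; have := kernel_ext_lty (subr_node_itv k xS t01).
by case: (kernel_ext K _) => [u| |]// _; rewrite ?ltry// gt0_muleNy ?lte_fin.
Qed.

Lemma sum_translates_lty x (t : R) : closed_simplex R n x -> 0 <= t <= 1 ->
  (F x t < +oo)%E.
Proof.
move=> xS t01; apply: lte_add_pinfty; first exact: field_lty.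
by apply: lte_sum_pinfty => k _; exact: translate_lty.
Qed.

Lemma sum_translatesE x (t : R) : closed_simplex R n x -> 0 <= t <= 1 ->
  J t \is a fin_num -> (forall k, t != x 0 k) ->
  F x t = (fine (J t) + \sum_(k < n) r k * fine (kernel_ext K (t - x 0 k)))%:E.
Proof.
move=> xS t01 Jt tx; rewrite EFinD fineK// -sumEFin; congr (_ + _)%E.
apply: eq_bigr => k _; rewrite EFinM fineK// kernel_ext_fin_num ?subr_eq0//.
exact: subr_node_itv.
Qed.

Lemma sum_translates_neqNy x (t : R) : closed_simplex R n x -> 0 <= t <= 1 ->
  F x t != -oo%E -> J t \is a fin_num /\ forall k, t != x 0 k.
Proof.
move=> xS t01.
rewrite /sum_translates adde_eq_ninfty negb_or => /andP[JtN sumN].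
split; first by rewrite fin_numE JtN lt_eqF// field_lty.
move=> k; apply: contra sumN => /eqP->; apply/eqP/esum_eqNyP; exists k.
split; rewrite ?mem_index_enum// subrr [kernel_ext _ _]singularK.
by rewrite gt0_muleNy// lte_fin.
Qed.

Lemma node_continuous (i : nat) : continuous (fun x => node x i).
Proof.
case: i => [|i]; first exact: cst_continuous.
rewrite /node; case: insubP => [k _ _|_]; last exact: cst_continuous.
exact: coord_continuous.
Qed.

Lemma closed_closed_simplex : closed (closed_simplex R n).
Proof.
rewrite (_ : closed_simplex R n =
    \bigcap_(j in [set: 'I_n.+1]) [set x | node x j <= node x j.+1]).
  by apply: closed_bigI => j _; apply: closed_le_fun; exact: node_continuous.
by apply/seteqP; split => x xS j; [move=> _|]; exact: xS.
Qed.

Lemma compact_closed_simplex : compact (closed_simplex R n).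
Proof.
pose cube := [set x : 'rV[R]_n | forall k, `[0, 1]%classic (x ord0 k)].
have -> : closed_simplex R n = cube `&` closed_simplex R n.
  apply/seteqP; split => [x xS|x []//]; split => // k.
  by rewrite /= in_itv/=; exact: simplex_itv.
apply: compact_closedI; last exact: closed_closed_simplex.
apply: (@rV_compact R n (fun=> `[0, 1]%classic)) => k.
exact: segment_compact.
Qed.

Definition interval_graph (j : 'I_n.+1) : set ('rV[R]_n * R) :=
  [set p : 'rV[R]_n * R |
    closed_simplex R n p.1 /\ node p.1 j <= p.2 <= node p.1 j.+1].

Lemma interval_itv x j (t : R) : closed_simplex R n x ->
  node x j <= t <= node x j.+1 -> 0 <= t <= 1.
Proof.
move=> xS; have jn := ltn_ord j.
have := @node_itv _ _ x j xS (ltnW jn); have := @node_itv _ _ x j.+1 xS jn.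
lra.
Qed.

Lemma closed_interval_graph j : closed (interval_graph j).
Proof.
have cnode i : continuous (fun p : 'rV[R]_n * R => node p.1 i).
  move=> p; apply: (@continuous_comp _ _ _ fst (fun x => node x i)).
    exact: cvg_fst.
  exact: node_continuous.
have csnd : continuous (snd : 'rV[R]_n * R -> R) by move=> p; exact: cvg_snd.
rewrite (_ : interval_graph j = (fst @^-1` closed_simplex R n) `&`
  ([set p | node p.1 j <= p.2] `&` [set p | p.2 <= node p.1 j.+1])).
  apply: closedI; last by apply: closedI; apply: closed_le_fun.
  apply: closed_comp; last exact: closed_closed_simplex.
  by move=> p _; exact: cvg_fst.
apply/seteqP; split => p /= [xS]; first by move=> /andP.
by move=> pj; split => //; exact/andP.
Qed.

Lemma usc_on_sum_translates :
  usc_on [set p : 'rV[R]_n * R | closed_simplex R n p.1 /\ 0 <= p.2 <= 1]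
    (fun p => F p.1 p.2).
Proof.
apply: usc_onD.
- by move=> p [_ p01]; exact: field_lty.
- by move=> p [xS p01]; apply: lte_sum_pinfty => k _; exact: translate_lty.
- apply: (@usc_on_comp _ _ _ _ (`[0, 1]%classic : set R) snd J).
  + by move=> p; exact: cvg_snd.
  + by move=> p [_ p01]; rewrite /= in_itv.
  + by move=> t a t01 Jt; exact: uscJ.
- apply: usc_on_sum => [k p [xS p01]|k]; first exact: translate_lty.
  apply: usc_onZ => //.
  apply: (@usc_on_comp _ _ _ _ (`[-1, 1]%classic : set R)
    (fun p : 'rV[R]_n * R => p.2 - p.1 0 k) (kernel_ext K)).
  + move=> p; apply: cvgB; first exact: cvg_snd.
    apply: (@continuous_comp _ _ _ fst (fun x : 'rV[R]_n => x 0 k)).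
      exact: cvg_fst.
    exact: coord_continuous.
  + by move=> p [xS p01]; rewrite /= in_itv/=; exact: subr_node_itv.
  + move=> s a; rewrite /= in_itv/= => s11 Ks.
    have := kernel_ext_lt kernelK singularK concaveK monotoneK s11 Ks.
    by apply: filterS => u Ku; rewrite in_itv.
Qed.

Lemma sub_interval_graph j :
  interval_graph j `<=`
    [set p : 'rV[R]_n * R | closed_simplex R n p.1 /\ 0 <= p.2 <= 1].
Proof. by move=> p [xS pj]; split => //; exact: interval_itv pj. Qed.

Lemma interval_max_attained x j : closed_simplex R n x ->
  exists2 z, node x j <= z <= node x j.+1 & m x j = F x z.
Proof.
move=> xS.
have [|||z] :=
  @usc_on_max _ _ (`[node x j, node x j.+1]%classic : set R) (F x).
- exact: segment_compact.
- by exists (node x j); rewrite /= in_itv/= lexx xS.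
- apply: (@usc_on_comp _ _ _ _ _ (fun t => (x, t)) (fun p => F p.1 p.2))
    (usc_on_subset (@sub_interval_graph j) usc_on_sum_translates).
    by move=> t; exact: (cvg_pair (@cvg_cst _ x _ _ _) cvg_id).
  by move=> t /=; rewrite in_itv.
rewrite /= in_itv/= => zx zmax; exists z => //.
apply/eqP; rewrite eq_le; apply/andP; split.
  by apply: ge_ereal_sup => _ /= [t tx <-]; exact: zmax.
by apply: ereal_sup_ubound; exists z; rewrite //= in_itv.
Qed.

Lemma usc_on_interval_max j : usc_on (closed_simplex R n) (m ^~ j).
Proof.
have := @usc_on_sup_fiber _ _ _ (closed_simplex R n)
  (`[0, 1]%classic : set R) _ _
  (@segment_compact _ _ _) (@closed_interval_graph j) _
  (usc_on_subset (@sub_interval_graph j) usc_on_sum_translates).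
move=> /(_ _)-H x a xS mx.
have E y : closed_simplex R n y ->
    m y j = ereal_sup [set F y t | t in [set t | interval_graph j (y, t)]].
  move=> yS; rewrite /interval_max; congr ereal_sup.
  apply/seteqP; split => _ /= [t ty <-]; exists t => //.
  by case: ty => _ /= tyI; rewrite in_itv.
have : \forall y \near x, closed_simplex R n y ->
    (ereal_sup [set F y t | t in [set t | interval_graph j (y, t)]] < a%:E)%E.
  apply: H => //; last by rewrite -E.
  by move=> p /sub_interval_graph[_ p01]; rewrite /= in_itv.
by apply: filterS => y Hy yS; rewrite E//; exact: Hy.
Qed.

(** A degenerate interval consists of a single point, which is a component of
[x], and the singularity of the kernel makes the sum -oo there. *)
Lemma regular_open_simplex x : closed_simplex R n x ->
  (forall j, m x j != -oo%E) -> open_simplex R n x.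
Proof.
move=> xS mx j; rewrite lt_neqAle xS andbT; apply/eqP => e.
have [z zx mz] := interval_max_attained j xS.
have [||_ zk] := @sum_translates_neqNy x z xS; first exact: interval_itv zx.
  by rewrite -mz.
have ez : z = node x j by rewrite -e in zx; lra.
have [jn|nj] := ltnP j n.
  by have := zk (Ordinal jn); rewrite ez e (nodeS x (Ordinal jn)) eqxx.
have {nj}jn : j = n :> nat by have := ltn_ord j; lia.
have n_gt0 : (0 < n)%N.
  rewrite lt0n; apply: contra_eq_neq e => n0.
  have -> : node x j.+1 = 1 by rewrite jn node_last.
  have -> : node x j = 0 by rewrite (_ : nat_of_ord j = 0%N)// jn.
  by rewrite lt_eqF.
have n1n : (n.-1 < n)%N by rewrite prednK.
have := zk (Ordinal n1n).
have -> : x 0 (Ordinal n1n) = node x j.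
  by rewrite -nodeS; congr (node x _); rewrite jn /= prednK.
by rewrite ez eqxx.
Qed.

(** A maximum point [z] of [y] on its [j]-th interval also lies in the [j]-th
interval of [x], so it is enough to compare the two sums at [z]. *)
Lemma interval_max_lt x y j : closed_simplex R n x -> open_simplex R n y ->
  x != y -> balanced r x y j -> m y j != -oo%E -> (m y j < m x j)%E.
Proof.
move=> xS yS xy bal; have yS' := sub_open_closed_simplex yS.
have j_n : (j <= n)%N by rewrite -ltnS.
have [z zy mz] := interval_max_attained j yS'.
have z01 := interval_itv yS' zy.
rewrite mz => /(sum_translates_neqNy yS' z01)[Jz zk].
have xyl := balanced_left r_gt0 j_n bal.
have yxr := balanced_right r_gt0 j_n bal.
have zx : node x j <= z <= node x j.+1 by lra.
apply: (@lt_le_trans _ _ (F x z)); last first.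
  by apply: ereal_sup_ubound; exists z; rewrite //= in_itv.
have left k : (k < j)%N -> x 0 k < z /\ y 0 k < z.
  move=> kj.
  have yjz : node y j < z.
    rewrite lt_neqAle; case/andP: zy => -> _; rewrite andbT eq_sym.
    case: (nat_of_ord j) kj j_n => [//|i] _ i_n.
    by rewrite (nodeS y (Ordinal i_n)).
  have lek u : closed_simplex R n u -> u 0 k <= node u j.
    by move=> uS; rewrite -nodeS; apply: node_le => //; lia.
  by have := lek x xS; have := lek y yS'; lra.
have right k : (j <= k)%N -> z < x 0 k /\ z < y 0 k.
  move=> jk; have jn : (j < n)%N by exact: leq_ltn_trans (ltn_ord k).
  have zyj : z < node y j.+1.
    rewrite lt_neqAle; case/andP: zy => _ ->; rewrite andbT.
    by rewrite (nodeS y (Ordinal jn)).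
  have lek u : closed_simplex R n u -> node u j.+1 <= u 0 k.
    by move=> uS; rewrite -nodeS; apply: node_le => //; have := ltn_ord k; lia.
  by have := lek x xS; have := lek y yS'; lra.
rewrite !sum_translatesE// ?lte_fin ?ltrD2l.
  apply: (sum_kernel_lt r_gt0 concaveK monotoneK xS xy j_n bal z01) => // k.
  exact: open_simplex_itv.
move=> k; have [/left[xz _]|/right[zx' _]] := ltnP k j; first by rewrite gt_eqF.
by rewrite lt_eqF.
Qed.

End sum_of_translates.

(** * Existence of an equioscillation point *)

Lemma near0_affine_gt0 (R : realType) (c d : R) : 0 < c ->
  \forall h \near 0^'+, 0 < c + h * d.
Proof.
move=> c0; have : c + h * d @[h --> 0^'+] --> c + 0 * d.
  apply: cvgD; first exact: cvg_cst.
  by apply: cvgM; [exact: cvg_at_right_filter cvg_id|exact: cvg_cst].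
by rewrite mul0r addr0 => /cvgr_gt; exact.
Qed.

Section equioscillation.
Context {R : realType} {n : nat} (r : 'I_n -> R) (K : R -> R) (J : R -> \bar R).
Hypothesis r_gt0 : forall j, 0 < r j.
Hypothesis kernelK : kernel_function K.
Hypothesis singularK : singular_kernel K.
Hypothesis concaveK : strictly_concave_kernel K.
Hypothesis monotoneK : monotone_kernel K.
Hypothesis fieldJ : field_function n J.
Hypothesis uscJ : upper_semicontinuous_on `[0, 1] J.
Implicit Types (x y w : 'rV[R]_n) (k : 'I_n) (j : 'I_n.+1).

Local Notation F := (sum_translates r K J).
Local Notation m := (interval_max r K J).
Local Notation mmin := (min_interval_max r K J).
Local Notation mmax := (max_interval_max r K J).

(** Weights are at most 1, so the field is finite at n + 1 points at least;
put the nodes halfway between consecutive ones. *)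
Lemma exists_regular : exists2 y, open_simplex R n y & forall j, m y j != -oo%E.
Proof.
have [_ [s [s_uniq sP s_gt]]] := fieldJ.
have n_lt : (n < size s)%N.
  rewrite -(ltr_nat R); apply: lt_le_trans s_gt _.
  rewrite -sum1_size natr_sum; apply: ler_sum => t _.
  by rewrite /point_weight; case: ifP => _; lra.
pose s' := sort <=%R s; pose t (i : nat) := nth 0 s' i.
have t_lt i l : (i < l <= n)%N -> t i < t l.
  move=> /andP[il ln].
  rewrite /t /s' (lt_sorted_ltn_nth 0) ?sort_lt_sorted// inE /= size_sort.
    exact: ltn_trans il (leq_ltn_trans ln n_lt).
  exact: leq_ltn_trans ln n_lt.
have tP i : (i <= n)%N -> 0 <= t i <= 1 /\ J (t i) \is a fin_num.
  move=> i_n; have /sP[] : t i \in s.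
    by rewrite -(mem_sort <=%R) mem_nth// size_sort (leq_ltn_trans i_n).
  by rewrite in_itv.
pose y := \row_(k < n) ((t k + t k.+1) / 2).
have y_gt k : t k < y 0 k.
  by have := @t_lt k k.+1; rewrite mxE ltnSn ltn_ord => /(_ isT); lra.
have y_lt k : y 0 k < t k.+1.
  by have := @t_lt k k.+1; rewrite mxE ltnSn ltn_ord => /(_ isT); lra.
have lo (i : nat) : (i <= n)%N ->
    node y i <= t i /\ ((0 < i)%N -> node y i < t i).
  case: i => [|i] i_n; first by have [/andP[]] := tP 0%N i_n.
  have := y_lt (Ordinal i_n); rewrite -nodeS => yt.
  by split => [|_]; [exact: ltW|].
have hi (i : nat) : (i <= n)%N ->
    t i <= node y i.+1 /\ ((i < n)%N -> t i < node y i.+1).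
  rewrite leq_eqVlt => /predU1P[->|i_n].
    by rewrite node_last ltnn; have [/andP[]] := tP n (leqnn n).
  have := y_gt (Ordinal i_n); rewrite -nodeS => ty.
  by split => [|_]; [exact: ltW|].
have yS : open_simplex R n y.
  move=> j; have jn : (j <= n)%N by rewrite -ltnS.
  have [l1 l2] := lo j jn; have [h1 h2] := hi j jn.
  have [j0|j0] := posnP j; last exact: lt_le_trans (l2 j0) h1.
  have [jn'|nj] := ltnP j n; first exact: le_lt_trans l1 (h2 jn').
  have -> : node y j.+1 = 1.
    by rewrite (_ : nat_of_ord j = n) ?node_last//; lia.
  by rewrite j0 /= ltr01.
exists y => // j; have jn : (j <= n)%N by rewrite -ltnS.
have [tj01 Jtj] := tP j jn; have yS' := sub_open_closed_simplex yS.
have [l1 _] := lo j jn; have [h1 _] := hi j jn.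
have : (F y (t j) <= m y j)%E.
  by apply: ereal_sup_ubound; exists (t j) => //; rewrite /= in_itv/= l1.
rewrite (sum_translatesE r concaveK monotoneK yS' tj01 Jtj) => [|k].
  by apply: contraTneq => ->; rewrite leNgt ltNyr.
have [jk|kj] := leqP j k; apply/eqP => tjk.
  have := y_gt k; rewrite -tjk; have := @t_lt j k; have := ltn_ord k.
  move: jk; rewrite leq_eqVlt => /predU1P[->|jk]; first by rewrite ltxx.
  by rewrite jk /= => kn /(_ (ltnW kn)) /ltW; rewrite leNgt => /negbTE->.
have := y_lt k; rewrite -tjk; move: kj; rewrite leq_eqVlt => /predU1P[->|kj].
  by rewrite ltxx.
have := @t_lt k.+1 j; rewrite kj jn => /(_ isT)/ltW.
by rewrite leNgt => /negbTE->.
Qed.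

Lemma exists_maximin_point : exists2 w, closed_simplex R n w &
  forall x, closed_simplex R n x -> (mmin x <= mmin w)%E.
Proof.
apply: usc_on_max; first exact: compact_closed_simplex.
  have [y yS _] := exists_regular; exists y; exact: sub_open_closed_simplex.
by apply: usc_on_bigmin => j; exact: usc_on_interval_max.
Qed.

Lemma kernel_ext_concave (a b s : R) : -1 < a < 1 -> -1 < b < 1 -> 0 < a * b ->
  0 <= s <= 1 ->
  (1 - s) * fine (kernel_ext K a) + s * fine (kernel_ext K b) <=
  fine (kernel_ext K ((1 - s) * a + s * b)).
Proof.
move=> a11 b11 ab s01; have [concN concP _] := kernelK.
have cvx (lo hi : R) : lo < a < hi -> lo < b < hi ->
    lo < (1 - s) * a + s * b < hi.
  move=> aI bI; have [d|d] := leP a b.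
    have : 0 <= s * (b - a) by apply: mulr_ge0; lra.
    have : 0 <= (1 - s) * (b - a) by apply: mulr_ge0; lra.
    lra.
  have : 0 <= s * (a - b) by apply: mulr_ge0; lra.
  have : 0 <= (1 - s) * (a - b) by apply: mulr_ge0; lra.
  lra.
have [a0|a0|a0] := ltgtP a 0; last by rewrite a0 mul0r ltxx in ab.
  have b0 : b < 0 by move: ab; rewrite nmulr_rgt0.
  have c0 : -1 < (1 - s) * a + s * b < 0 by apply: cvx; lra.
  rewrite !kernel_extE /=;
    [|apply/eqP; lra|lra|apply/eqP; lra|lra|apply/eqP; lra|lra].
  have := concN a b (1 - s); rewrite /= !in_itv/= => H.
  by rewrite -{2 4}(subKr 1 s); apply: H; lra.
have b0 : 0 < b by move: ab; rewrite pmulr_rgt0.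
have c0 : 0 < (1 - s) * a + s * b < 1 by apply: cvx; lra.
rewrite !kernel_extE /=;
  [|apply/eqP; lra|lra|apply/eqP; lra|lra|apply/eqP; lra|lra].
have := concP a b (1 - s); rewrite /= !in_itv/= => H.
by rewrite -{2 4}(subKr 1 s); apply: H; lra.
Qed.

(** The end nodes of the [j]-th interval move towards each other; an end that is
not a component of [w] stays put. Dividing by the weights makes the displacement
constant outside [j], and larger at [j]. *)
Definition squeeze w j (h : R) : 'rV[R]_n :=
  \row_k (w 0 k + h * (((k.+1 == j)%:R - (k == j :> nat)%:R) / r k)).

(** Motion at constant speed, the speed being read off at time 1. *)
Lemma node_squeeze w j h (i : nat) :
  node (squeeze w j h) i =
  node w i + h * (node (squeeze w j 1) i - node w i).
Proof.
case: i => [|i]; rewrite /node; first by ring.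
by case: insubP => [k _ _|_]; rewrite ?mxE; ring.
Qed.

Lemma displacement_squeeze w j h (l : nat) : (l <= n)%N ->
  displacement r (squeeze w j h) w l = h * ((l == j)%:R - (0%N == j)%:R).
Proof.
elim: l => [|l IH] ln; first by rewrite /displacement big_pred0// subrr mulr0.
rewrite (displacementS r _ _ (Ordinal ln)) IH 1?ltnW// mxE /=.
by field; rewrite gt_eqF.
Qed.

Lemma balanced_squeeze w j h (i : nat) : 0 < h -> (i <= n)%N -> i != j ->
  balanced r (squeeze w j h) w i.
Proof.
move=> h0 i_n ij l ln; rewrite !displacement_squeeze// ler_pM2l// lerD2r.
by rewrite (negPf ij) ler0n.
Qed.

Lemma squeeze_neq w j h : (0 < n)%N -> 0 < h -> squeeze w j h != w.
Proof.
move=> n_gt0 h0; apply/eqP => e.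
have D0 l : (l <= n)%N -> (l == j)%:R = (0%N == j)%:R :> R.
  move=> ln; have := displacement_squeeze w j h ln.
  rewrite e {1}/displacement big1 => [|k _]; last by rewrite subrr mulr0.
  by move=> /esym/eqP; rewrite mulf_eq0 gt_eqF//= subr_eq0 => /eqP.
have := D0 j; rewrite -ltnS ltn_ord eqxx => /(_ isT).
case: eqP => [j0 _|_ /eqP]; last by rewrite oner_eq0.
have := D0 n (leqnn n); rewrite -j0 eqxx gtn_eqF// => /esym/eqP.
by rewrite oner_eq0.
Qed.

(** At a maximum point [z] the sum of translates is a concave function of the
time h, as long as no node crosses [z]. It therefore stays above its chord up
to some small time h0, and the chord stays above [a] near 0. *)
Lemma squeeze_interval_max w j (a : R) : open_simplex R n w ->
  (a%:E < m w j)%E ->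
  exists2 h, 0 < h & open_simplex R n (squeeze w j h) /\
    (a%:E < m (squeeze w j h) j)%E.
Proof.
move=> wS; have wS' := sub_open_closed_simplex wS.
have [z zw ->] := interval_max_attained r_gt0 kernelK singularK concaveK
  monotoneK fieldJ uscJ j wS'.
have z01 := interval_itv wS' zw => aF.
have [Jz zk] : J z \is a fin_num /\ forall k, z != w 0 k.
  apply: (@sum_translates_neqNy _ _ r K J) => //.
  by apply: contraTneq aF => ->; rewrite ltNge leNye.
pose same h := forall k, 0 < (z - w 0 k) * (z - squeeze w j h 0 k).
have near_simplex : \forall h \near 0^'+, open_simplex R n (squeeze w j h).
  apply: filter_forall => i.
  have := @near0_affine_gt0 _ (node w i.+1 - node w i)
    ((node (squeeze w j 1) i.+1 - node w i.+1)
      - (node (squeeze w j 1) i - node w i)).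
  rewrite subr_gt0 => /(_ (wS i)); apply: filterS => h.
  by move=> H; rewrite [ltLHS]node_squeeze [ltRHS]node_squeeze; lra.
have near_same : \forall h \near 0^'+, same h.
  apply: filter_forall => k.
  have := @near0_affine_gt0 _ ((z - w 0 k) ^+ 2)
    (- (z - w 0 k) * (squeeze w j 1 0 k - w 0 k)).
  rewrite exprn_even_gt0/= ?subr_eq0 ?zk// => /(_ isT); apply: filterS => h.
  by rewrite -(nodeS (squeeze w j h)) node_squeeze !nodeS expr2; lra.
have h_gt0 : \forall h \near 0^'+, 0 < h :> R by exact: nbhs_right_gt.
have [h0 [h0_gt0 h0S h0z]] : exists h0,
    [/\ 0 < h0, open_simplex R n (squeeze w j h0) & same h0].
  by near (0 : R)^'+ => h; exists h; split; near: h.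
pose S x := fine (J z) + \sum_(k < n) r k * fine (kernel_ext K (z - x 0 k)).
have FS x : closed_simplex R n x -> (forall k, z != x 0 k) -> F x z = (S x)%:E.
  by move=> xS zx; apply: sum_translatesE.
rewrite FS// lte_fin in aF.
have [h [h_0 h_h0 hS hz ha]] : exists h, [/\ 0 < h, h < h0,
    open_simplex R n (squeeze w j h), same h &
    a < S w + h * ((S (squeeze w j h0) - S w) / h0)].
  near (0 : R)^'+ => h; exists h; split; near: h => //.
    exact: nbhs_right_lt.
  have := @near0_affine_gt0 _ (S w - a) ((S (squeeze w j h0) - S w) / h0).
  by rewrite subr_gt0 => /(_ aF); apply: filterS => h; lra.
exists h => //; split => //.
have hS' := sub_open_closed_simplex hS.
have zh k : z != squeeze w j h 0 k.
  by have := hz k; apply: contraTneq => <-; rewrite subrr mulr0 ltxx.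
have side k : (w 0 k < z) = (squeeze w j h 0 k < z).
  apply/idP/idP => kz; have := hz k.
    by rewrite pmulr_rgt0 subr_gt0.
  by rewrite pmulr_lgt0 subr_gt0.
have j_n : (j <= n)%N by rewrite -ltnS.
have zI : node (squeeze w j h) j <= z <= node (squeeze w j h) j.+1.
  case/andP: zw => wz zw; apply/andP; split.
    case: (nat_of_ord j) j_n wz => [//|i] i_n.
    rewrite (nodeS w (Ordinal i_n)) => wz.
    rewrite (nodeS (squeeze w j h) (Ordinal i_n)).
    by apply: ltW; rewrite -side lt_neqAle eq_sym zk.
  move: j_n zw; rewrite leq_eqVlt => /predU1P[->|jn].
    by rewrite !node_last.
  rewrite (nodeS w (Ordinal jn)) (nodeS (squeeze w j h) (Ordinal jn)).
  by rewrite !leNgt -side.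
apply: (@lt_le_trans _ _ (F (squeeze w j h) z)); last first.
  by apply: ereal_sup_ubound; exists z => //; rewrite /= in_itv.
rewrite FS// lte_fin; apply: lt_le_trans ha _.
set s := h / h0; have s01 : 0 <= s <= 1.
  by rewrite /s divr_ge0 ?ler_pdivrMr//; lra.
have -> : h * ((S (squeeze w j h0) - S w) / h0) =
    s * (S (squeeze w j h0) - S w).
  by rewrite /s; ring.
have -> : S w + s * (S (squeeze w j h0) - S w) = fine (J z) + \sum_(k < n)
    r k * ((1 - s) * fine (kernel_ext K (z - w 0 k))
      + s * fine (kernel_ext K (z - squeeze w j h0 0 k))).
  rewrite /S (_ : forall a b c : R, a + b + s * (a + c - (a + b)) =
    a + ((1 - s) * b + s * c)); last by move=> *; ring.
  rewrite !mulr_sumr -big_split/=; congr (_ + _); apply: eq_bigr => k _; ring.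
rewrite lerD2l; apply: ler_sum => k _; rewrite ler_pM2l//.
have -> : z - squeeze w j h 0 k =
    (1 - s) * (z - w 0 k) + s * (z - squeeze w j h0 0 k).
  rewrite !mxE /s; field; rewrite !gt_eqF//=.
apply: kernel_ext_concave => //.
- by have := open_simplex_itv k wS; lra.
- by have := open_simplex_itv k h0S; lra.
Unshelve. all: by end_near. Qed.

Lemma interval_max_lty w j : closed_simplex R n w -> (m w j < +oo)%E.
Proof.
move=> wS.
have [z zw ->] := interval_max_attained r_gt0 kernelK singularK concaveK
  monotoneK fieldJ uscJ j wS.
exact/sum_translates_lty/(interval_itv wS zw).
Qed.

Lemma min_interval_max_le w j : (mmin w <= m w j)%E.
Proof. exact: bigmin_le. Qed.

Lemma max_interval_max_ge w j : (m w j <= mmax w)%E.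
Proof. exact: le_bigmax. Qed.

(** The maximiser of the smallest interval maximum: squeezing an interval whose
maximum is not the smallest would increase the smallest one. *)
Lemma exists_equioscillation : exists2 w, open_simplex R n w &
  exists mu : R, forall j, m w j = mu%:E.
Proof.
have [w wS wmax] := exists_maximin_point.
have [y yS my] := exists_regular.
have minN : (-oo < mmin w)%E.
  apply: lt_le_trans (wmax y (sub_open_closed_simplex yS)).
  by apply/bigmin_gtP; split=> [|j _]; rewrite ltNye ?my.
have wj j : (-oo < m w j)%E := lt_le_trans minN (min_interval_max_le w j).
have wS' : open_simplex R n w.
  apply: (@regular_open_simplex _ _ r K J) => // j.
  by rewrite -ltNye.
have minfin : mmin w \is a fin_num.
  rewrite fin_numElt minN; apply: le_lt_trans (min_interval_max_le w ord0) _.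
  exact: interval_max_lty.
exists w => //; exists (fine (mmin w)) => j; rewrite fineK//.
apply/eqP; rewrite eq_le min_interval_max_le andbT leNgt; apply/negP => wj_gt.
have [n0|n_gt0] := posnP n.
  have jE (i : 'I_n.+1) : i = j.
    by apply: val_inj => /=; have := ltn_ord i; have := ltn_ord j; lia.
  move: wj_gt; apply/negP; rewrite -leNgt; apply/bigmin_geP; split.
    exact: leey.
  by move=> i _; rewrite (jE i).
rewrite -(fineK minfin) in wj_gt.
have [h h0 [hS hj]] := squeeze_interval_max wS' wj_gt.
have hS' := sub_open_closed_simplex hS.
have := wmax _ hS'; apply/negP; rewrite -ltNge.
apply/bigmin_gtP; split=> [|i _]; first by rewrite ltey_eq minfin.
have [->|ij] := eqVneq i j; first by rewrite -(fineK minfin).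
apply: le_lt_trans (min_interval_max_le w i) _.
apply: interval_max_lt => //; first exact: squeeze_neq.
  by apply: balanced_squeeze => //; rewrite -ltnS.
by rewrite -ltNye.
Qed.

(** The first inequality uses the comparison from [x] to [w], the second one
from [w] to [x]. *)
Lemma equioscillation_strict w x (mu : R) : open_simplex R n w ->
  (forall j, m w j = mu%:E) -> closed_simplex R n x -> x != w ->
  (mmin x < mu%:E)%E /\ (mu%:E < mmax x)%E.
Proof.
move=> wS wmu xS xw; have wS' := sub_open_closed_simplex wS; split; last first.
  have [i bal] := exists_balanced r x w.
  apply: lt_le_trans (max_interval_max_ge x i); rewrite -(wmu i).
  by apply: interval_max_lt => //; rewrite wmu.
have [reg|/forallPn[i]] := boolP [forall j, m x j != -oo%E]; last first.
  rewrite negbK => /eqP xi; apply: le_lt_trans (min_interval_max_le x i) _.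
  by rewrite xi ltNyr.
have {}reg j : m x j != -oo%E by exact: (forallP reg).
have xS' : open_simplex R n x by exact: (@regular_open_simplex _ _ r K J).
have [i bal] := exists_balanced r w x.
apply: le_lt_trans (min_interval_max_le x i) _; rewrite -(wmu i).
by apply: interval_max_lt => //; rewrite eq_sym.
Qed.

End equioscillation.

(** * Minimax and maximin *)

Theorem corollary3p1 (R : realType) (n : nat) (r : 'I_n -> R) (K : R -> R)
    (J : R -> \bar R)
    (r_gt0 : forall j, 0 < r j)
    (kernelK : kernel_function K)
    (singularK : singular_kernel K)
    (concaveK : strictly_concave_kernel K)
    (monotoneK : monotone_kernel K)
    (fieldJ : field_function n J)
    (uscJ : upper_semicontinuous_on `[0, 1] J) :
  minimax r K J = maximin r K J /\
  (exists w : 'rV[R]_n,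
     [/\ unique (equioscillation_point r K J) w,
         regularity_set r K J w,
         unique (minimax_point r K J) w &
         unique (maximin_point r K J) w]) /\
  (forall x : 'rV[R]_n, open_simplex R n x ->
     (min_interval_max r K J x <= minimax r K J)%E /\
     minimax r K J = maximin r K J /\
     (maximin r K J <= max_interval_max r K J x)%E).
Proof.
have [w wS [mu wmu]] := exists_equioscillation r_gt0 kernelK singularK concaveK
  monotoneK fieldJ uscJ.
have wS' := sub_open_closed_simplex wS.
have strict x := equioscillation_strict r_gt0 kernelK singularK concaveK
  monotoneK fieldJ uscJ wS wmu (x := x).
have minw : min_interval_max r K J w = mu%:E.
  apply/eqP; rewrite eq_le -{1}(wmu ord0) min_interval_max_le/=.
  by apply/bigmin_geP; split=> [|j _]; rewrite ?leey ?wmu.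
have maxw : max_interval_max r K J w = mu%:E.
  apply/eqP; rewrite eq_le -{2}(wmu ord0) max_interval_max_ge andbT.
  by apply/bigmax_leP; split=> [|j _]; rewrite ?leNye ?wmu.
have min_le x : closed_simplex R n x -> (min_interval_max r K J x <= mu%:E)%E.
  by move=> xS; have [->|/(strict x xS)[/ltW]] := eqVneq x w; rewrite ?minw.
have max_ge x : closed_simplex R n x -> (mu%:E <= max_interval_max r K J x)%E.
  by move=> xS; have [->|/(strict x xS)[_ /ltW]] := eqVneq x w; rewrite ?maxw.
have minimaxE : minimax r K J = mu%:E.
  apply/eqP; rewrite eq_le; apply/andP; split.
    by apply: ereal_inf_lbound; exists w.
  apply: le_ereal_inf_tmp => _ /= [x xS <-].
  exact/max_ge/sub_open_closed_simplex.
have maximinE : maximin r K J = mu%:E.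
  apply/eqP; rewrite eq_le; apply/andP; split; last first.
    by apply: ereal_sup_ubound; exists w.
  apply: ge_ereal_sup => _ /= [x xS <-]; exact/min_le/sub_open_closed_simplex.
split; first by rewrite minimaxE maximinE.
split; last first.
  move=> x /sub_open_closed_simplex xS; rewrite minimaxE maximinE.
  by split; [exact: min_le|split => //; exact: max_ge].
exists w; split.
- split=> [|v [vS veq]]; first by split => // j k; rewrite !wmu.
  apply/eqP; rewrite eq_sym; apply: contraT => /(strict v vS)[lt_mu gt_mu].
  have := lt_trans lt_mu gt_mu; rewrite ltNge => /negP; case.
  apply: (@le_trans _ _ (interval_max r K J v ord0)).
    by apply/bigmax_leP; split=> [|j _]; rewrite ?leNye// (veq j ord0).
  by apply/bigmin_geP; split=> [|j _]; rewrite ?leey// (veq j ord0).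
- by split => // j; rewrite wmu.
- split=> [|v [vS vmax]]; first by split; rewrite // maxw minimaxE.
  apply/eqP; rewrite eq_sym; apply: contraT => /(strict v vS)[_].
  by rewrite vmax minimaxE ltxx.
- split=> [|v [vS vmin]]; first by split; rewrite // minw maximinE.
  apply/eqP; rewrite eq_sym; apply: contraT => /(strict v vS)[+ _].
  by rewrite vmin maximinE ltxx.
Qed.
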